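(* The sequence $(\rho_k)_{k\ge0}$ converges pointwise on $\mathbb{R}_{\ge0}^2$ to the minimum of the problem with unlimited randomization: for all $z,c\ge0$, $$\lim_{k\to\infty}\rho_k(z,c)=\rho(z,c)=\min_{\psi\in\mathcal{I}_c^\infty}\ \alpha(\psi)+z\,\beta(\psi).$$
   Context: $(\mathcal{X},\mathcal{F})$ is a measurable space, $\bm{X} = (X_1,X_2,\ldots)$ a random sequence in $\mathcal{X}$, $\bm{x}_t=(x_1,\ldots,x_t)$. Under hypothesis $\mathcal{H}_i$, $i\in\{0,1\}$, $\bm{X}$ is i.i.d. according to $P_i$. Standing assumptions: $P_1$ is absolutely continuous with respect to $P_0$, and $D_{\mathrm{KL}}(P_0\Vert P_1)$ is non-zero and finite; $p_0,p_1$ are the densities of $P_0,P_1$ with respect to a suitable background measure. $g(z)=\min\{1,z\}$ for $z\ge0$. A stopping policy is a sequence $\psi=(\psi_0,\psi_1,\ldots)$ of (measurable) functions $\psi_t=\psi_t(\bm{x}_t)\in[0,1]$ ($\psi_0$ a constant), where $\psi_t(\bm{x}_t)$ is the probability of stopping at time $t$ given that the test has not stopped before and $\bm{x}_t$ has been observed. $T$ is the resulting stopping time, with $\mathbb{P}[T=t\mid\bm{X}_t=\bm{x}_t]=\psi_t(\bm{x}_t)\prod_{n=0}^{t-1}(1-\psi_n(\bm{x}_n))$. $\mathcal{I}_c^\infty$ is the set of stopping policies $\psi$ such that, for every $\bm{x}\in\mathcal{X}^\infty$, the conditional expectation of $T$ given $\bm{X}=\bm{x}$ is at most $c$ (equivalently,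 $\mathbb{E}_{\mathbf{P},\psi}[T]\le c$ for every distribution $\mathbf{P}$ of $\bm{X}$ on $\mathcal{X}^\infty$). $\mathcal{I}_{c,k}^\infty=\{\psi\in\mathcal{I}_c^\infty:\sum_{t=0}^T\mathbf{1}_{(0,1)}(\psi_t)\le k\}$, i.e. in any run of the test at most $k$ randomized stopping decisions are used. $\alpha(\psi)$ and $\beta(\psi)$ are the Type I and Type II error probabilities (the probability of deciding for $\mathcal{H}_1$ under $\mathcal{H}_0$, and for $\mathcal{H}_0$ under $\mathcal{H}_1$) of the test that uses stopping policy $\psi$ and, upon stopping at $T=t$, decides for $\mathcal{H}_1$ if $z\prod_{n=1}^t\frac{p_1(x_n)}{p_0(x_n)}>1$, for $\mathcal{H}_0$ if it is $<1$, and arbitrarily if it equals $1$. Thus $\alpha(\psi)+z\beta(\psi)=\mathbb{E}_{0,\psi}\bigl[g\bigl(z\prod_{t=1}^T\frac{p_1(X_t)}{p_0(X_t)}\bigr)\bigr]$, where $\mathbb{E}_{0,\psi}$ is expectation under $\mathcal{H}_0$ and policy $\psi$. For $k\in\mathbb{N}_{\ge0}$, $\rho_k:\mathbb{R}_{\ge0}^2\to[0,1]$ is $\rho_k(z,c)=\inf_{\psi\in\mathcal{I}_{c,k}^\infty}\alpha(\psi)+z\beta(\psi)$; $\rho$ denotes the pointwise limit. *)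

(* Defs.v *)
From HB Require Import structures.
From mathcomp Require Import all_boot all_order all_algebra finmap.
From mathcomp Require Import all_classical all_reals all_analysis.

Set Implicit Arguments.
Unset Strict Implicit.
Unset Printing Implicit Defensive.
Import Order.TTheory GRing.Theory Num.Theory.
Import numFieldNormedType.Exports.
Local Open Scope classical_set_scope.
Local Open Scope ring_scope.

(* Sequences are indexed from 0: [x i] is the observation written x_(i+1) on
   paper, so that [initial x t] is (x_1, ..., x_t). *)
Definition initial (T : Type) (x : nat -> T) (t : nat) : t.-tuple T :=
  [tuple x i | i < t].

(* Stopping policies are of this type; so are the rules that break the ties of
   the final decision. *)
Record randomized_rule (R : realType) (d : measure_display)
    (T : measurableType d) := RandomizedRule {
  rule_prob :> forall t : nat, t.-tuple T -> R ;
  rule_measurable : forall t, measurable_fun [set: t.-tuple T] (@rule_prob t) ;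
  rule_itv01 : forall t (x : t.-tuple T), 0 <= @rule_prob t x <= 1 }.

Arguments rule_prob {R d T} _ _ _.

Section policies.
Context {R : realType} {d : measure_display} {T : measurableType d}.
Implicit Types (psi : randomized_rule R T) (x : nat -> T).

(* The conditional probability, given the sequence of observations x, that the
   stopping time of psi equals t. *)
Definition stop_prob psi x (t : nat) : R :=
  psi t (initial x t) * \prod_(n < t) (1 - psi n (initial x n)).

(* The conditional expectation of the stopping time given x. The second summand
   is the contribution of the event that the test never stops (+oo * 0 = 0). *)
Definition expected_stop psi x : \bar R :=
  (\sum_(t <oo) (t%:R * stop_prob psi x t)%:E
   + +oo * (1 - \sum_(t <oo) (stop_prob psi x t)%:E))%E.

Definition constrained_policies (c : R) : set (randomized_rule R T) :=
  [set psi | forall x, (expected_stop psi x <= c%:E)%E].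

Definition randomization_count psi x (t : nat) : nat :=
  (\sum_(n < t.+1) (0 < psi n (initial x n) < 1)%R)%N.

(* A run of the test is a sequence x together with a time t at which the test
   stops with positive probability given x. *)
Definition constrained_policies_rand (c : R) (k : nat) :
    set (randomized_rule R T) :=
  constrained_policies c `&`
  [set psi | forall x t, 0 < stop_prob psi x t ->
     (randomization_count psi x t <= k)%N].

End policies.

Section hypotheses.
Context {R : realType} {d : measure_display} {T : measurableType d}.

Definition is_density (mu : set T -> \bar R) (P : set T -> \bar R)
    (p : T -> R) : Prop :=
  [/\ measurable_fun [set: T] p, (forall x, 0 <= p x) &
      forall A, measurable A -> P A = (\int[mu]_(x in A) (p x)%:E)%E].

(* Since lne 0 = -oo, the integrand is +oo where p > 0 = q, and it is 0
   wherever p = 0. *)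
Definition kl_divergence (mu : set T -> \bar R) (p q : T -> R) : \bar R :=
  (\int[mu]_x ((p x)%:E * (lne (p x)%:E - lne (q x)%:E)))%E.

Definition mutually_independent (d' : measure_display) (O : measurableType d')
    (Pr : set O -> \bar R) (X : nat -> O -> T) : Prop :=
  forall (J : {fset nat}) (A : nat -> set T), (forall j, measurable (A j)) ->
    Pr (\bigcap_(j in [set` J]) (X j @^-1` A j)) =
    (\prod_(j <- J) Pr (X j @^-1` A j))%E.

Definition iid_according_to (d' : measure_display) (O : measurableType d')
    (Pr : set O -> \bar R) (X : nat -> O -> T) (P : set T -> \bar R) : Prop :=
  mutually_independent Pr X /\
  forall n A, measurable A -> pushforward Pr (X n) A = P A.

End hypotheses.

Section tests.
Context {R : realType} {d : measure_display} {T : measurableType d}.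
Variables (p0 p1 : T -> R) (tie : randomized_rule R T) (z : R).

Definition likelihood_ratio (t : nat) (x : t.-tuple T) : R :=
  \prod_(i < t) (p1 (tnth x i) / p0 (tnth x i)).

(* The probability of deciding for H_1 upon stopping with observations x; the
   decision is arbitrary (given by tie) when z * likelihood_ratio x = 1. *)
Definition decide1 (t : nat) (x : t.-tuple T) : R :=
  if 1 < z * likelihood_ratio x then 1
  else if z * likelihood_ratio x < 1 then 0
  else tie t x.

Context {d' : measure_display} {O : measurableType d'}.
Variables (Pr0 Pr1 : set O -> \bar R) (X : nat -> O -> T).

Definition type1_error (psi : randomized_rule R T) : \bar R :=
  (\sum_(t <oo) \int[Pr0]_w
    (stop_prob psi (X ^~ w) t * decide1 (initial (X ^~ w) t))%:E)%E.

Definition type2_error (psi : randomized_rule R T) : \bar R :=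
  (\sum_(t <oo) \int[Pr1]_w
    (stop_prob psi (X ^~ w) t * (1 - decide1 (initial (X ^~ w) t)))%:E)%E.

Definition weighted_error (psi : randomized_rule R T) : \bar R :=
  (type1_error psi + z%:E * type2_error psi)%E.

Definition rho_ (k : nat) (c : R) : \bar R :=
  ereal_inf [set weighted_error psi | psi in constrained_policies_rand c k].

End tests.

Definition is_minimum (R : realType) (U : Type) (A : set U) (f : U -> \bar R)
    (v : \bar R) : Prop :=
  (exists2 u, A u & f u = v) /\ forall u, A u -> (v <= f u)%E.

(* Main.v *)
(* A policy is determined by its survival process S_t = P(T > t | x_1, ..., x_t),
   and the constraint E[T | x] <= c reads S_0 + S_1 + ... <= c for every x; the
   admissible processes form a convex set on which the weighted error is affine.

   Convergence of rho_k: S is nonincreasing with sum at most c, so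
   S_(k-1) <= c / k; stopping at time k at the latest costs at most
   (1 + z) c / k and leaves at most k randomized decisions.

   Existence of a minimizer: among the processes with error at most inf + e take
   one that nearly minimizes the sum over t of E_0[S_t^2] + E_1[S_t^2] <= 2 c. By
   the parallelogram identity these processes are Cauchy as e -> 0, hence along a
   fast sequence they converge almost surely under both hypotheses. Their
   pointwise lower limit satisfies the constraint for every x, and by dominated
   convergence its error does not exceed the infimum. *)

Require Import Defs.
From mathcomp Require Import all_boot all_order all_algebra.
From mathcomp Require Import all_classical all_reals all_analysis.
From mathcomp Require Import measurable_realfun zify lra.

Import Order.TTheory GRing.Theory Num.Theory.
Import numFieldNormedType.Exports.
Local Open Scope classical_set_scope.
Local Open Scope ring_scope.

Set Implicit Arguments.
Unset Strict Implicit.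
Unset Printing Implicit Defensive.

(** * Near-minimizers in a set closed under midpoints *)

(** [J] is the cost and [N] an auxiliary energy with convexity defect [D]. The midpoint of two
    near-minimizers of [J] is again one, so among those that also nearly minimize [N] its energy
    cannot drop much below theirs, which forces [D] to be small. *)
Lemma near_minimal_midpoint_sequence (R : realType) (V : Type) (C : set V)
    (mid : V -> V -> V) (J N : V -> R) (D : V -> V -> R) (B : R)
    (eta : nat -> R) :
  C !=set0 ->
  (forall a b, C a -> C b -> C (mid a b)) ->
  (forall a, C a -> 0 <= J a) ->
  (forall a b, C a -> C b -> J (mid a b) <= (J a + J b) / 2) ->
  (forall a, C a -> 0 <= N a <= B) ->
  (forall a b, C a -> C b -> N (mid a b) + D a b <= (N a + N b) / 2) ->
  (forall k, 0 < eta k) -> nonincreasing_seq eta ->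
  exists u : nat -> V, [/\ forall k, C (u k),
    forall k, J (u k) <= inf (J @` C) + eta k &
    forall k, D (u k) (u k.+1) <= 2 * eta k].
Proof.
move=> [a0 Ca0] Cmid J0 Jmid NB ND eta0 eta_dec.
set A := inf (J @` C).
have Jinf : has_inf (J @` C).
  by split; [exists (J a0); exists a0|exists 0 => _ [a Ca <-]; exact: J0].
pose low e x := forall a, C a -> J a <= A + e -> x <= N a.
have nearJ e : 0 < e -> exists2 a, C a & J a <= A + e.
  move=> e0; have [_ [a Ca <-] /ltW aA] := inf_adherent e0 Jinf.
  by exists a.
(* [sup Y] is the limit, as e tends to 0, of the infimum of [N] over the points with
   [J a <= A + e]. *)
pose Y := [set x | exists2 e, 0 < e & low e x].
have Ysup : has_sup Y.
  split; first by exists 0, 1 => // a /NB/andP[].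
  exists B => x [e e0 ex]; have [a Ca aA] := nearJ e e0.
  by rewrite (le_trans (ex a Ca aA))//; have /andP[] := NB a Ca.
set E := sup Y.
have step k : exists p : R * V, [/\ 0 < p.1 <= eta k, C p.2,
    J p.2 <= A + p.1, N p.2 < E + eta k & low p.1 (E - eta k)].
  have [x [e e0 ex] Ex] := sup_adherent (eta0 k) Ysup.
  pose e' := Num.min e (eta k).
  have e'0 : 0 < e' by rewrite lt_min e0 eta0.
  have [a [Ca aA aE]] : exists a, [/\ C a, J a <= A + e' & N a < E + eta k].
    (* Otherwise [E + eta k] would bound [N] from below at level [e'], hence lie in [Y], above its
       supremum. *)
    apply: contrapT => no.
    have : Y (E + eta k).
      exists e' => // a Ca aA; rewrite leNgt; apply/negP => aE.
      by apply: no; exists a.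
    by move/(sup_upper_bound Ysup); rewrite gerDl leNgt eta0.
  exists (e', a); split=> //=; first by rewrite e'0 ge_min lexx orbT.
  move=> b Cb bA; rewrite (le_trans (ltW Ex))//; apply: ex => //.
  by rewrite (le_trans bA)// lerD2l ge_min lexx.
have [p hp] := choice step.
exists (fun k => (p k).2); split=> k; have [/andP[e0 ek] Ck Jk Nk lk] := hp k.
- by [].
- by rewrite (le_trans Jk)// lerD2l.
- have [/andP[e0' ek'] Ck' Jk' Nk' lk'] := hp k.+1.
  have dk := eta_dec k k.+1 (leqnSn k).
  have : E - eta k <= N (mid (p k).2 (p k.+1).2).
    have Jm := Jmid _ _ Ck Ck'; have Cm := Cmid _ _ Ck Ck'.
    (* The midpoint belongs to the larger of the two levels, so the lower bound attached to that
       level applies. *)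
    have [le|/ltW le] := leP (p k).1 (p k.+1).1; last by apply: lk => //; lra.
    by apply: (le_trans _ (lk' _ Cm _)); lra.
  by have := ND _ _ Ck Ck'; lra.
Qed.

(** * Lower limits of sequences in the unit interval *)

Section lower_limit.
Context {R : realType}.
Implicit Types (u : nat -> R) (M l e : R).

(** A lower limit exists for every sequence in [0,1], convergent or not, so a limit process can be
    defined on every sample path. *)
Definition lower_limit u : R := - limn_sup (fun k => - u k).

Let bounded01 u := forall k, 0 <= u k <= 1.

Let cvg_sups_lower u : bounded01 u ->
  sups (fun k => - u k) k @[k --> \oo] --> - lower_limit u.
Proof.
move=> u01; rewrite opprK; apply: cvgP; apply: cvg_sups_inf.
- by exists 0 => _ [k _ <-]; have /andP[? _] := u01 k; rewrite oppr_le0.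
- by exists (-1) => _ [k _ <-]; have /andP[_ ?] := u01 k; rewrite lerN2.
Qed.

Lemma lower_limit_lt u e : bounded01 u -> 0 < e ->
  \forall k \near \oo, lower_limit u - e < u k.
Proof.
move=> u01 e0; have := cvg_sups_lower u01.
move=> /cvgrPdist_lt /(_ e e0); apply: filterS => k.
rewrite ltr_distlC => /andP[_ h].
have : - u k <= sups (fun k => - u k) k.
  apply: ub_le_sup; last by exists k => /=.
  by exists 0 => _ [j _ <-]; have /andP[? _] := u01 j; rewrite oppr_le0.
by lra.
Qed.

Lemma lower_limit_ge u M : bounded01 u ->
  (\forall k \near \oo, M <= u k) -> M <= lower_limit u.
Proof.
move=> u01 [n _ hM]; rewrite -lerN2; apply: (@cvgr_to_le _ _ _ _ _ _ _ (cvg_sups_lower u01)).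
exists n => // k /= nk; apply: sup_le_ub; first by exists (- u k), k => /=.
by move=> _ [j /= kj <-]; rewrite lerN2; apply: hM => /=; exact: leq_trans kj.
Qed.

Lemma lower_limit_cvg u l : bounded01 u -> u k @[k --> \oo] --> l ->
  lower_limit u = l.
Proof.
move=> u01 ul.
have /cvg_sups/cvg_lim : (fun k => - u k : R^o) @ \oo --> - l by exact: cvgN.
by rewrite /lower_limit /limn_sup => ->//; rewrite opprK.
Qed.

Lemma lower_limit_itv01 u : bounded01 u -> 0 <= lower_limit u <= 1.
Proof.
move=> u01; rewrite lower_limit_ge//=; last first.
  by apply: nearW => k; have /andP[] := u01 k.
apply/ler_addgt0Pr => e e0; have [n _ /(_ n (leqnn n))] := lower_limit_lt u01 e0.
by have /andP[_] := u01 n; lra.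
Qed.

Lemma le_lower_limit u v : bounded01 u -> bounded01 v ->
  (forall k, u k <= v k) -> lower_limit u <= lower_limit v.
Proof.
move=> u01 v01 uv; apply/ler_addgt0Pr => e e0; rewrite -lerBlDr.
apply: lower_limit_ge => //; apply: filterS (lower_limit_lt u01 e0) => k /ltW h.
exact: le_trans (uv k).
Qed.

(** Finitely many terms eventually all exceed their lower limits minus a common slack, so one index
    [k] serves the whole sum. *)
Lemma sum_lower_limit_le (u : nat -> nat -> R) n M :
  (forall t, bounded01 (u^~ t)) ->
  (forall k, \sum_(t < n) u k t <= M) ->
  \sum_(t < n) lower_limit (u^~ t) <= M.
Proof.
move=> u01 uM; apply/ler_addgt0Pr => e e0.
(* Dividing by [n.+1] also covers the empty sum; the [n] slacks add up to at most [e]. *)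
have e'0 : 0 < e / n.+1%:R by rewrite divr_gt0.
have : \forall k \near \oo, forall t : 'I_n,
    lower_limit (u^~ t) - e / n.+1%:R < u k t.
  by apply: filter_forall => t; exact: lower_limit_lt.
move=> [k _ /(_ k (leqnn k)) h].
have : \sum_(t < n) (lower_limit (u^~ t) - e / n.+1%:R) <= M.
  by rewrite (le_trans _ (uM k))//; apply: ler_sum => t _; exact: ltW.
rewrite sumrB sumr_const card_ord -[_ *+ n]mulr_natr => h'.
have : e / n.+1%:R * n%:R <= e.
  rewrite mulrAC -mulrA; apply: ler_piMr; first exact: ltW.
  by rewrite ler_pdivrMr// mul1r ler_nat.
by move=> h2; rewrite lerBlDr in h'; apply: (le_trans h'); rewrite lerD2l.
Qed.

Lemma measurable_lower_limit d (T : measurableType d) (u : nat -> T -> R) :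
  (forall x, bounded01 (u^~ x)) -> (forall k, measurable_fun setT (u k)) ->
  measurable_fun setT (fun x => lower_limit (u^~ x)).
Proof.
move=> u01 mu; apply: measurableT_comp => //.
apply: (@measurable_fun_limn_sup _ _ _ setT (fun k x => - u k x)) => [x _|x _|k].
- by exists 0 => _ [k _ <-]; have /andP[? _] := u01 x k; rewrite oppr_le0.
- by exists (-1) => _ [k _ <-]; have /andP[_ ?] := u01 x k; rewrite lerN2.
- exact: measurableT_comp.
Qed.

End lower_limit.

(** * Stopping policies and survival processes *)

Lemma measurable_fun_inv (R : realType) :
  measurable_fun [set: R] (@GRing.inv R).
Proof.
have -> : [set: R] = [set x | x != 0] `|` [set 0].
  apply/seteqP; split=> // x _ /=.
  by have [->|?] := eqVneq x 0; [right|left].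
have oN0 : open [set x : R | x != 0] by exact: open_neq.
apply/measurable_funU; [exact: open_measurable|exact: measurable_set1|].
split; last exact: measurable_fun_set1.
apply: open_continuous_measurable_fun => // x; rewrite inE /=.
exact: inv_continuous.
Qed.

Lemma measurable_fun_div d (T : measurableType d) (R : realType) (f g : T -> R) :
  measurable_fun setT f -> measurable_fun setT g ->
  measurable_fun setT (fun x => f x / g x).
Proof.
move=> mf mg; apply: measurable_funM => //.
exact: (measurableT_comp (@measurable_fun_inv R)).
Qed.

(** * Law and mean of a stopping time from its survival function *)

Section stopping_mass.
Context {R : realType}.
Implicit Types s : nat -> R.

(* The law of a stopping time T given its survival function s n = P(T > n). *)
Definition mass s (t : nat) : R := (if t is t'.+1 then s t' else 1) - s t.

Definition mean_time s : \bar R :=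
  (\sum_(t <oo) (t%:R * mass s t)%:E
   + +oo * (1 - \sum_(t <oo) (mass s t)%:E))%E.

Lemma sum_mass s n : \sum_(t < n.+1) mass s t = 1 - s n.
Proof.
elim: n => [|n ih]; first by rewrite big_ord1.
by rewrite big_ord_recr/= ih /mass; lra.
Qed.

(** Summation by parts; the last term corrects for the mass still surviving after time [n]. *)
Lemma sum_time_mass s n :
  \sum_(t < n.+1) t%:R * mass s t = \sum_(t < n) s t - n%:R * s n.
Proof.
elim: n => [|n ih]; first by rewrite big_ord1 big_ord0 /=; lra.
rewrite big_ord_recr/= ih big_ord_recr/= /mass -natr1; lra.
Qed.

Context (s : nat -> R).
Hypotheses (s01 : forall n, 0 <= s n <= 1) (s_dec : nonincreasing_seq s).

Lemma mass_ge0 t : 0 <= mass s t.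
Proof.
rewrite subr_ge0; case: t => [|t]; first by have /andP[] := s01 0.
exact: s_dec.
Qed.

Lemma mass_le1 t : mass s t <= 1.
Proof.
have /andP[s0 _] := s01 t; rewrite /mass; case: t s0 => [|t] s0; first by lra.
by have /andP[_ ?] := s01 t; lra.
Qed.

(** The terms [s 0], ..., [s n] are all at least [s n]: a Markov inequality, the source of the rate
    [c / k]. *)
Lemma time_survival_le (c : R) n : (forall n, \sum_(t < n) s t <= c) ->
  n.+1%:R * s n <= c.
Proof.
move=> /(_ n.+1); apply: le_trans.
have -> : n.+1%:R * s n = \sum_(t < n.+1) s n.
  by rewrite sumr_const card_ord mulr_natl.
by apply: ler_sum => i _; apply: s_dec; rewrite -ltnS.
Qed.

Let mass_partial n :
  (\sum_(0 <= t < n.+1) (mass s t)%:E)%E = (1 - s n)%:E.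
Proof. by rewrite sumEFin big_mkord sum_mass. Qed.

Let cvg_mass : (\sum_(0 <= t < n.+1) (mass s t)%:E)%E @[n --> \oo] -->
  (\sum_(t <oo) (mass s t)%:E)%E.
Proof.
have := @cvg_shiftS _ (fun n => \sum_(0 <= t < n) (mass s t)%:E)%E.
move=> ->; by apply: is_cvg_nneseries => t _ _; rewrite lee_fin mass_ge0.
Qed.

Lemma mass_total_le1 : (\sum_(t <oo) (mass s t)%:E <= 1)%E.
Proof.
rewrite -(cvg_lim _ cvg_mass)//; apply: lime_le; first exact: cvgP cvg_mass.
apply: nearW => n; rewrite mass_partial lee_fin.
by have /andP[? _] := s01 n; lra.
Qed.

(** The tail formula E[T] = sum of P(T > t). Either bound forces [s] to tend to 0, so no mass is
    lost at infinity and summation by parts passes to the limit. *)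
Lemma mean_time_leP (c : R) : 0 <= c ->
  (mean_time s <= c%:E)%E <-> forall n, \sum_(t < n) s t <= c.
Proof.
move=> c0; have tm0 t : (0 <= (t%:R * mass s t)%:E)%E.
  by rewrite lee_fin mulr_ge0// mass_ge0.
split.
- move=> le_c n.
  (* Missing mass would make [mean_time s] infinite. *)
  have total : (\sum_(t <oo) (mass s t)%:E = 1)%E.
    apply/eqP; rewrite eq_le mass_total_le1 /= leNgt; apply/negP => lt1.
    move: le_c; rewrite /mean_time gt0_mulye; last by rewrite sube_gt0.
    rewrite addey; first by rewrite leye_eq.
    by rewrite gt_eqF// (lt_le_trans (ltNyr 0))// nneseries_ge0.
  move: le_c; rewrite /mean_time total subee// mule0 adde0 => le_c.
  have s0 : s n @[n --> \oo] --> (0 : R).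
    have : (fine (\sum_(0 <= t < n.+1) (mass s t)%:E)%E) @[n --> \oo] --> (1 : R).
      by apply: fine_cvg; rewrite -total; exact: cvg_mass.
    under eq_fun do rewrite mass_partial /=.
    move=> h; have : 1 - (1 - s n) @[n --> \oo] --> (1 - 1 : R).
      by apply: cvgB => //; exact: cvg_cst.
    by rewrite subrr; under eq_fun do rewrite subKr.
  have bound m : (n <= m)%N -> \sum_(t < n) s t - n%:R * s m <= c.
    move=> nm; have : ((\sum_(t < m.+1) t%:R * mass s t)%:E <= c%:E)%E.
      apply: le_trans le_c; rewrite -(big_mkord predT (fun t => t%:R * mass s t)).
      rewrite -sumEFin; apply: nneseries_lim_ge => t _ _; exact: tm0.
    rewrite lee_fin sum_time_mass; apply: le_trans.
    have sumB k : \sum_(t < k) s t - k%:R * s m = \sum_(t < k) (s t - s m).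
      by rewrite sumrB sumr_const card_ord -[s m *+ k]mulr_natl.
    rewrite !sumB -(big_mkord predT (fun t => s t - s m)).
    rewrite -(big_mkord predT (fun t => s t - s m)).
    rewrite (@big_cat_nat _ _ _ n 0 m)//= lerDl big_nat sumr_ge0// => t /andP[_ tm].
    by rewrite subr_ge0 s_dec// ltnW.
  have lim : \sum_(t < n) s t - n%:R * s m @[m --> \oo] -->
      \sum_(t < n) s t - n%:R * 0.
    by apply: cvgB; [exact: cvg_cst|apply: cvgM => //; exact: cvg_cst].
  rewrite -[leLHS]subr0 -[X in _ - X](mulr0 n%:R).
  by apply: (cvgr_to_le lim); exists n => // m /=; exact: bound.
- move=> le_c.
  have s0 : s n @[n --> \oo] --> (0 : R).
    apply: (@squeeze_cvgr _ _ _ _ (cst 0) (fun n => c * harmonic n)).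
    + apply: nearW => n; have /andP[-> _] := s01 n.
      by rewrite ler_pdivlMr// mulrC time_survival_le.
    + exact: cvg_cst.
    + suff : c * harmonic n @[n --> \oo] --> c * 0 by rewrite mulr0.
      by apply: cvgMl_tmp; exact: cvg_harmonic.
  have total : (\sum_(t <oo) (mass s t)%:E = 1)%E.
    rewrite -(cvg_lim _ cvg_mass)//; apply/cvg_lim => //.
    under eq_fun do rewrite mass_partial.
    apply: cvg_EFin; first exact: nearW.
    suff : 1 - s n @[n --> \oo] --> (1 - 0 : R) by rewrite subr0.
    by apply: cvgB => //; exact: cvg_cst.
  rewrite /mean_time total subee// mule0 adde0; apply: lime_le.
    by apply: is_cvg_nneseries => t _ _; exact: tm0.
  apply: nearW => -[|n]; first by rewrite big_geq// lee_fin.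
  rewrite sumEFin big_mkord sum_time_mass lee_fin (le_trans _ (le_c n))//.
  by rewrite gerBl mulr_ge0//; have /andP[] := s01 n.
Qed.

End stopping_mass.

(** * Correspondence between policies and survival processes *)

Section survival_process.
Context {R : realType} {d : measure_display} {T : measurableType d}.
Implicit Types (psi : randomized_rule R T) (x : nat -> T)
  (S : forall t : nat, t.-tuple T -> R).

Definition front n (y : n.+1.-tuple T) : n.-tuple T :=
  [tuple tnth y (widen_ord (leqnSn n) i) | i < n].

Lemma front_initial x n : front (initial x n.+1) = initial x n.
Proof. by apply: eq_from_tnth => i; rewrite !tnth_mktuple. Qed.

Lemma measurable_front n : measurable_fun setT (@front n).
Proof.
apply/measurable_fun_tnthP => i.
rewrite [X in measurable_fun _ X](_ : _ =
  (@tnth n.+1 T)^~ (widen_ord (leqnSn n) i)); first exact: measurable_tnth.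
by apply/funext => y /=; rewrite tnth_mktuple.
Qed.

Definition along S x (t : nat) : R := S t (initial x t).

Fixpoint survival psi (t : nat) : t.-tuple T -> R :=
  if t is t'.+1 then fun y => survival psi (front y) * (1 - psi t'.+1 y)
  else fun y => 1 - psi 0 y.

(* Policies with E[T | x] <= c correspond to these processes, because
   E[T | x] is the sum over t of P(T > t | x) = survival psi (x_1, ..., x_t). *)
Definition survival_process (c : R) : set (forall t, t.-tuple T -> R) :=
  [set S : forall t, t.-tuple T -> R | [/\ forall t, measurable_fun setT (S t),
    forall t y, 0 <= S t y <= 1,
    forall t (y : t.+1.-tuple T), S t.+1 y <= S t (front y) &
    forall x n, \sum_(t < n) along S x t <= c]].

Lemma along_itv01 c S : survival_process c S ->
  forall x t, 0 <= along S x t <= 1.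
Proof. by move=> [_ S01 _ _] x t; exact: S01. Qed.

Lemma along_nonincreasing c S : survival_process c S ->
  forall x, nonincreasing_seq (along S x).
Proof.
move=> [_ _ Sdec _] x; apply/nonincreasing_seqP => t.
by rewrite (le_trans (Sdec _ _))// front_initial.
Qed.

Lemma along_survival psi x t :
  along (survival psi) x t = \prod_(n < t.+1) (1 - psi n (initial x n)).
Proof.
elim: t => [|t ih]; first by rewrite big_ord1.
by rewrite big_ord_recr/= -ih /along /= front_initial.
Qed.

(** P(T = t) is the drop from P(T > t-1) to P(T > t), since the second equals the first times
    [1 - psi t]. *)
Lemma stop_probE psi x t : stop_prob psi x t = mass (along (survival psi) x) t.
Proof.
rewrite /stop_prob /mass; case: t => [|t].
  by rewrite big_ord0 mulr1 /along/= opprB addrC subrK.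
have -> : along (survival psi) x t.+1 =
    along (survival psi) x t * (1 - psi t.+1 (initial x t.+1)).
  by rewrite /along /= front_initial.
by rewrite -along_survival; lra.
Qed.

Lemma expected_stopE psi x :
  expected_stop psi x = mean_time (along (survival psi) x).
Proof.
rewrite /expected_stop /mean_time.
by congr (_ + _ * (1 - _))%E; apply: eq_eseriesr => t _; rewrite stop_probE.
Qed.

(** Measurability, range and monotonicity hold for the survival process of any policy; the bound on
    its sums carries the constraint, through the tail formula. *)
Lemma constrained_policiesP psi (c : R) : 0 <= c ->
  constrained_policies c psi <-> survival_process c (@survival psi).
Proof.
move=> c0; have S01 t (y : t.-tuple T) : 0 <= survival psi y <= 1.
  elim: t y => [|t ih] y /=; first by have /andP[] := rule_itv01 psi y; lra.
  have /andP[a0 a1] := ih (front y); have /andP[b0 b1] := rule_itv01 psi y.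
  by rewrite mulr_ge0 ?subr_ge0// mulr_ile1// ?subr_ge0// lerBlDr lerDl.
have Sdec t (y : t.+1.-tuple T) : survival psi y <= survival psi (front y).
  have /andP[a0 _] := S01 _ (front y); have /andP[b0 _] := rule_itv01 psi y.
  by rewrite /= ler_piMr// lerBlDr lerDl.
have p01 x t : 0 <= along (survival psi) x t <= 1 by exact: S01.
have pdec x : nonincreasing_seq (along (survival psi) x).
  by apply/nonincreasing_seqP => t; rewrite (le_trans (Sdec _ _))// front_initial.
split=> [h|[_ _ _ h] x]; last by rewrite expected_stopE; apply/mean_time_leP.
split=> //; last by move=> x; apply/mean_time_leP => //; rewrite -expected_stopE.
elim=> [|t ih] /=; apply: measurable_funM || apply: measurable_funB => //.
- exact: rule_measurable.
- by apply: measurableT_comp => //; exact: measurable_front.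
- by apply: measurable_funB => //; exact: rule_measurable.
Qed.

(* [x / 0 = 0], so that the hazard rate is 1 where S already vanishes. *)
Definition hazard S (t : nat) : t.-tuple T -> R :=
  if t is t'.+1 then fun y => 1 - S t'.+1 y / S t' (front y)
  else fun y => 1 - S 0 y.

(** A process is the running product of its successive ratios, so stopping with the hazard rate
    recovers it. *)
Lemma survival_process_policy S c : survival_process c S ->
  exists psi, @survival psi = S.
Proof.
move=> [mS S01 Sdec _].
have mh t : measurable_fun setT (@hazard S t).
  case: t => [|t] /=; apply: measurable_funB => //; first exact: mS.
  apply: measurable_fun_div; first exact: mS.
  by apply: measurableT_comp; [exact: mS|exact: measurable_front].
have h01 t (y : t.-tuple T) : 0 <= hazard S y <= 1.
  case: t y => [|t] y /=; first by have /andP[] := S01 _ y; lra.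
  have /andP[a0 _] := S01 _ y; have := S01 _ (front y); have := Sdec _ y.
  rewrite le_eqVlt => le /andP[].
  rewrite le_eqVlt => /predU1P[<-|b0] _; first by rewrite invr0 mulr0; lra.
  have : S t.+1 y / S t (front y) <= 1.
    by rewrite ler_pdivrMr// mul1r le_eqVlt.
  have : 0 <= S t.+1 y / S t (front y) by rewrite divr_ge0// ltW.
  by lra.
exists (RandomizedRule mh h01); apply: functional_extensionality_dep.
elim=> [|t ih]; apply/funext => y /=.
  by rewrite subKr.
(* Where the previous value is 0, monotonicity makes [S t.+1 y] vanish too, so the default value of
   the quotient is harmless. *)
rewrite ih subKr mulrC; have [b0|b0] := eqVneq (S t (front y)) 0.
  apply/esym/eqP; rewrite b0 mulr0 eq_le; have /andP[-> _] := S01 _ y.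
  by rewrite -b0 Sdec.
by rewrite divfK.
Qed.

Lemma survival_process_mid c S S' : survival_process c S ->
  survival_process c S' ->
  survival_process c (fun t y => (S t y + S' t y) / 2).
Proof.
move=> [mS S01 Sdec Sc] [mS' S01' Sdec' Sc']; split.
- move=> t; apply: measurable_funM; last exact: measurable_cst.
  by apply: measurable_funD; [exact: mS|exact: mS'].
- by move=> t y; have := S01 t y; have := S01' t y; lra.
- by move=> t y; have := Sdec t y; have := Sdec' t y; lra.
- move=> x n; rewrite -mulr_suml big_split/=.
  by have := Sc x n; have := Sc' x n; rewrite /along; lra.
Qed.

(** Apart from measurability, each condition is pointwise and involves finitely many times, so it
    passes to lower limits on every sample path, without exceptional null sets. *)
Lemma survival_process_lower_limit c (S : nat -> forall t, t.-tuple T -> R) :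
  (forall k, survival_process c (S k)) ->
  survival_process c (fun t y => lower_limit (fun k => S k t y)).
Proof.
move=> hS; have S01 t (y : t.-tuple T) k : 0 <= S k t y <= 1.
  by have [_ + _ _] := hS k; exact.
split.
- move=> t; apply: (@measurable_lower_limit _ _ _ (fun k => S k t)).
    by move=> y k; exact: S01.
  by move=> k; have [mS _ _ _] := hS k; exact: mS.
- by move=> t y; apply: lower_limit_itv01; exact: S01.
- move=> t y; apply: le_lower_limit => k; [exact: S01|exact: S01|].
  by have [_ _ + _] := hS k; exact.
- move=> x n; apply: (@sum_lower_limit_le _ (fun k t => along (S k) x t)).
    by move=> t k; exact: S01.
  by move=> k; have [_ _ _ h] := hS k; exact: h.
Qed.

(** From time [k] on the decision is deterministic, so at most the [k] decisions at times 0, ...,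
    k-1 are randomized. *)
Definition truncated_prob psi (k t : nat) (y : t.-tuple T) : R :=
  if (t < k)%N then psi t y else 1.

Lemma truncated_policy psi (k : nat) : exists psi', forall t (y : t.-tuple T),
  psi' t y = truncated_prob psi k y.
Proof.
have m t : measurable_fun setT (@truncated_prob psi k t).
  rewrite /truncated_prob; case: (t < k)%N => //; exact: rule_measurable.
have h01 t (y : t.-tuple T) : 0 <= truncated_prob psi k y <= 1.
  by rewrite /truncated_prob; case: ifP => _; [exact: rule_itv01|rewrite ler01/=].
by exists (RandomizedRule m h01).
Qed.

(** * Truncation of a policy at time [k] *)

Section truncation.
Context (psi psi' : randomized_rule R T) (k : nat).
Hypothesis psi'E : forall t (y : t.-tuple T),
  psi' t y = truncated_prob psi k y.

Lemma along_truncated x t : along (survival psi') x t =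
  if (t < k)%N then along (survival psi) x t else 0.
Proof.
rewrite !along_survival; case: ltnP => [tk|kt].
  apply: eq_bigr => n _; rewrite psi'E /truncated_prob ifT//.
  by rewrite (leq_trans _ tk).
apply/eqP; rewrite prodf_seq_eq0; apply/hasP.
exists (Ordinal (kt : (k < t.+1)%N)); first by rewrite mem_index_enum.
by rewrite /= psi'E /truncated_prob ltnn subrr.
Qed.

(** Truncation only lowers the survival process, which preserves the bound on its sums, and every
    randomized decision comes before time [k]. *)
Lemma truncated_constrained c : 0 <= c -> constrained_policies c psi ->
  constrained_policies_rand c k psi'.
Proof.
move=> c0 /(constrained_policiesP _ c0) sp; have [_ _ _ Sc] := sp.
have p01 := along_itv01 sp; split.
  move=> x; rewrite expected_stopE; apply/mean_time_leP => //.
  - by move=> t; rewrite along_truncated; case: ifP => //; rewrite lexx ler01.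
  - apply/nonincreasing_seqP => t; rewrite !along_truncated.
    case: (ltnP t.+1 k) => [tk|_]; first by rewrite ltnW// (along_nonincreasing sp).
    by case: ifP => //; have /andP[] := p01 x t.
  - move=> n; apply: le_trans (Sc x n); apply: ler_sum => t _.
    by rewrite along_truncated; case: ifP => //; have /andP[] := p01 x t.
move=> x t; rewrite stop_probE => m0.
have tk : (t <= k)%N.
  rewrite leqNgt; apply/negP => kt; move: m0; rewrite /mass.
  case: t kt => // t kt; rewrite !along_truncated.
  by rewrite !ifF; [rewrite subrr ltxx|lia|lia].
rewrite /randomization_count.
rewrite (leq_trans (n := \sum_(n < t.+1) (n < k : nat)))//.
  apply: leq_sum => n _; rewrite psi'E /truncated_prob.
  by case: ifP => _; [exact: leq_b1|rewrite ltxx andbF].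
suff -> : (\sum_(n < t.+1) (n < k : nat) = minn t.+1 k)%N by exact: geq_minr.
by elim: t.+1 => [|n ih]; [rewrite big_ord0|rewrite big_ord_recr/= ih]; lia.
Qed.

(** All the mass of the event T >= k moves to time [k]; it is P(T > k-1), or 1 if [k = 0]. *)
Lemma mass_truncated x t : mass (along (survival psi') x) t =
  if (t < k)%N then mass (along (survival psi) x) t
  else if t == k then (if k is k'.+1 then along (survival psi) x k' else 1)
  else 0.
Proof.
rewrite /mass; case: t => [|t]; rewrite !along_truncated.
  by case: k => //=; rewrite subr0.
case: (ltnP t.+1 k) => [tk|]; first by rewrite ltnW.
rewrite leq_eqVlt => /predU1P[->|kt]; first by rewrite eqxx ltnSn subr0.
by rewrite gtn_eqF// ifF; [rewrite subrr|lia].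
Qed.

End truncation.
End survival_process.

(** * Sums of integrals *)

Section sum_of_integrals.
Context {R : realType} {d : measure_display} {O : measurableType d}.
Variable Pr : probability O R.
Implicit Types h : nat -> O -> R.

Definition sum_integral h : \bar R := (\sum_(t <oo) \int[Pr]_w (h t w)%:E)%E.

Definition nonneg_measurable h :=
  forall t, measurable_fun setT (h t) /\ forall w, 0 <= h t w.

Let integral_ge0' h t : nonneg_measurable h -> (0 <= \int[Pr]_w (h t w)%:E)%E.
Proof.
by move=> mh; apply: integral_ge0 => w _; rewrite lee_fin; have [_ ->] := mh t.
Qed.

Lemma sum_integral_ge0 h : nonneg_measurable h -> (0 <= sum_integral h)%E.
Proof. by move=> mh; apply: nneseries_ge0 => t _ _; exact: integral_ge0'. Qed.

Lemma partial_sum_integral_le h n : nonneg_measurable h ->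
  (\sum_(0 <= t < n) \int[Pr]_w (h t w)%:E <= sum_integral h)%E.
Proof. by move=> mh; apply: nneseries_lim_ge => t _ _; exact: integral_ge0'. Qed.

Lemma cvg_sum_integral h : nonneg_measurable h ->
  (\sum_(0 <= t < n) \int[Pr]_w (h t w)%:E)%E @[n --> \oo] --> sum_integral h.
Proof.
by move=> mh; apply: is_cvg_nneseries => t _ _; exact: integral_ge0'.
Qed.

Lemma sum_integralD h h' : nonneg_measurable h -> nonneg_measurable h' ->
  sum_integral (fun t w => h t w + h' t w) =
  (sum_integral h + sum_integral h')%E.
Proof.
move=> mh mh'; rewrite /sum_integral -nneseriesD; first last.
- by move=> t _ _; exact: integral_ge0'.
- by move=> t _ _; exact: integral_ge0'.
apply: eq_eseriesr => t _; have [m p] := mh t; have [m' p'] := mh' t.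
rewrite -ge0_integralD//.
- by move=> w _; rewrite lee_fin.
- exact/measurable_EFinP.
- by move=> w _; rewrite lee_fin.
- exact/measurable_EFinP.
Qed.

Lemma sum_integralZ h (k : R) : nonneg_measurable h -> 0 <= k ->
  sum_integral (fun t w => k * h t w) = (k%:E * sum_integral h)%E.
Proof.
move=> mh k0; rewrite /sum_integral -nneseriesZl; last first.
  by move=> t _; exact: integral_ge0'.
apply: eq_eseriesr => t _; have [m p] := mh t.
rewrite -ge0_integralZl_EFin//; first by move=> w _; rewrite lee_fin.
exact/measurable_EFinP.
Qed.

Lemma integral_le_cst (f : O -> R) (B : R) : measurable_fun setT f ->
  (forall w, 0 <= f w <= B) -> (\int[Pr]_w (f w)%:E <= B%:E)%E.
Proof.
move=> mf fB; rewrite (@le_trans _ _ (\int[Pr]_w (cst B%:E w))%E)//; last first.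
  by rewrite integral_cst//= probability_setT mule1.
apply: ge0_le_integral => //.
- by move=> w _; rewrite lee_fin; have /andP[] := fB w.
- exact/measurable_EFinP.
- by move=> w _; rewrite lee_fin; have /andP[] := fB w.
Qed.

Lemma sum_integral_le h (B : R) : nonneg_measurable h ->
  (forall w n, \sum_(t < n) h t w <= B) -> (sum_integral h <= B%:E)%E.
Proof.
move=> mh hB; rewrite -(cvg_lim _ (cvg_sum_integral mh))//.
apply: lime_le; first exact: cvgP (cvg_sum_integral mh).
apply: nearW => n; rewrite -ge0_integral_sum//=; first last.
- by move=> t w _; rewrite lee_fin; have [_ ->] := mh t.
- by move=> t; apply/measurable_EFinP; have [] := mh t.
under eq_integral do rewrite sumEFin.
apply: (integral_le_cst (f := fun w => \sum_(0 <= t < n) h t w)).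
  by apply: measurable_sum => t; have [] := mh t.
move=> w; rewrite big_mkord hB sumr_ge0// => t _.
by have [_ ->] := mh t.
Qed.

(** Dominated convergence, term by term, with the constant 1 as integrable bound. *)
Lemma cvg_partial_sum_integral (h : nat -> nat -> O -> R) h' n :
  (forall k, nonneg_measurable (h k)) -> nonneg_measurable h' ->
  (forall k t w, h k t w <= 1) ->
  (forall t, {ae Pr, forall w, h k t w @[k --> \oo] --> h' t w}) ->
  (\sum_(0 <= t < n) \int[Pr]_w (h k t w)%:E)%E @[k --> \oo] -->
  (\sum_(0 <= t < n) \int[Pr]_w (h' t w)%:E)%E.
Proof.
move=> mh mh' h1 cvgh; apply: cvg_nnesum => t _.
  by apply: nearW => k; exact: integral_ge0'.
have [] := @dominated_convergence _ _ _ Pr setT measurableT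
  (fun k w => (h k t w)%:E) (fun w => (h' t w)%:E) (cst 1%:E) => //.
- by move=> k; apply/measurable_EFinP; have [] := mh k t.
- by apply/measurable_EFinP; have [] := mh' t.
- apply: filterS (cvgh t) => w hw _.
  by apply: cvg_EFin; [exact: nearW|exact: hw].
- exact: finite_measure_integrable_cst.
- apply: aeW => w k _; rewrite lee_fin ger0_norm ?h1//.
  by have [_ ->] := mh k t.
Qed.

Definition geometric_rate (k : nat) : R := 1 / (2 ^ k.+1)%:R.

Lemma geometric_rate_gt0 k : 0 < geometric_rate k.
Proof. by rewrite divr_gt0// ltr0n expn_gt0. Qed.

Lemma nonincreasing_geometric_rate : nonincreasing_seq geometric_rate.
Proof.
move=> m n mn; rewrite ler_pM2l// lef_pV2 ?posrE ?ltr0n ?expn_gt0//.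
by rewrite ler_nat leq_exp2l.
Qed.

(* AM-GM bounds |f k - f (k+1)| by q_k + g_k where the series of the q_k
   converges and that of the g_k has a finite integral. *)
Lemma ae_cvg_of_square_increments (f : nat -> O -> R) :
  (forall k, measurable_fun setT (f k)) ->
  (forall k, (\int[Pr]_w (((f k w - f k.+1 w) / 2) ^+ 2)%:E <=
    (2 * geometric_rate k ^+ 2)%:E)%E) ->
  {ae Pr, forall w, cvgn (f ^~ w)}.
Proof.
move=> mf hf; pose q := geometric_rate.
have q0 k : 0 < q k by exact: geometric_rate_gt0.
(* Dividing by [q k] turns the bound [2 * q k ^+ 2] on the integrals into the summable [2 * q k]. *)
pose g k w := (q k)^-1 * ((f k w - f k.+1 w) / 2) ^+ 2.
have g0 k w : 0 <= g k w by rewrite mulr_ge0 ?sqr_ge0// invr_ge0 ltW.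
have msq k : measurable_fun setT (fun w => ((f k w - f k.+1 w) / 2) ^+ 2).
  by apply: measurable_funX; apply: measurable_funM => //; exact: measurable_funB.
have mg k : measurable_fun setT (fun w => (g k w)%:E).
  by apply/measurable_EFinP; apply: measurable_funM.
have sumg : (\int[Pr]_w (\sum_(k <oo) (g k w)%:E) < +oo)%E.
  rewrite integral_nneseries//; last by move=> *; rewrite lee_fin.
  apply: (@le_lt_trans _ _ 2%:E); last exact: ltry.
  apply: (@le_trans _ _ (\sum_(k <oo) (2 / (2 ^ k.+1)%:R)%:E)%E); last first.
    exact: epsilon_trick0.
  apply: lee_nneseries => k _.
    by move=> _; apply: integral_ge0 => w _; rewrite lee_fin.
  rewrite /g; under eq_integral do rewrite EFinM.
  rewrite ge0_integralZl_EFin//; first last.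
  - by rewrite invr_ge0 ltW.
  - exact/measurable_EFinP.
  - by move=> w _; rewrite lee_fin sqr_ge0.
  have -> : (2 / (2 ^ k.+1)%:R)%:E = ((q k)^-1%:E * (2 * q k ^+ 2)%:E)%E.
    rewrite -EFinM; congr EFin; rewrite expr2 mulrCA mulKf ?gt_eqF//.
    by rewrite /q /geometric_rate mul1r.
  by rewrite lee_pmul2l ?lte_fin ?invr_gt0//; exact: hf.
have : Pr.-integrable setT (fun w => \sum_(k <oo) (g k w)%:E)%E.
  apply/integrableP; split.
    by apply: ge0_emeasurable_sum => // k w _ _; rewrite lee_fin.
  apply: le_lt_trans sumg; rewrite le_eqVlt; apply/orP; left; apply/eqP.
  apply: eq_integral => w _; rewrite gee0_abs//.
  by apply: nneseries_ge0 => k _ _; rewrite lee_fin.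
(* An integrable function is finite almost everywhere; from here on [w] is a point where the series
   of the [g k w] converges. *)
move/(integrable_ae measurableT); apply: filterS => w /(_ I) fin.
have cg : cvgn (series (g^~ w)).
  by apply: nnseries_is_cvg => //; rewrite ltey_eq fin.
have cq : cvgn (series q).
  apply: nnseries_is_cvg => [k|]; first exact: ltW.
  by apply: le_lt_trans (ltry 1); exact: epsilon_trick0.
have ct : cvgn (series (telescope (f^~ w))).
  apply: normed_cvg; apply: (series_le_cvg _ _ _ (is_cvg_seriesD cq cg)) => k /=.
  - exact: normr_ge0.
  - by rewrite addr_ge0// ltW.
  - have qk0 := q0 k; rewrite /telescope /= distrC.
    rewrite [leRHS](_ : _ = q k + g k w)// /g.
    set a := f k w - f k.+1 w.
    (* Multiplied by [q k], the claim becomes [0 <= (q k - |a| / 2) ^+ 2]. *)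
    rewrite -(ler_pM2l qk0) mulrDr mulVKf ?gt_eqF// -subr_ge0.
    have -> : (a / 2) ^+ 2 = (`|a| / 2) ^+ 2.
      by rewrite !expr_div_n -[in RHS]normrX ger0_norm ?sqr_ge0.
    by have := sqr_ge0 (q k - `|a| / 2); nra.
rewrite (_ : f^~ w = fun k => f 0 w + series (telescope (f^~ w)) k).
  by apply: is_cvgD => //; exact: is_cvg_cst.
by apply/funext => k; exact: (eq_sum_telescope (f^~ w)).
Qed.

End sum_of_integrals.

(** * Real-valued sums of integrals *)

Section bounded_sums.
Context {R : realType} {d : measure_display} {O : measurableType d}.
Implicit Types (h : nat -> O -> R) (Pr : probability O R).

(** The uniform bound keeps [sum_integral] finite, so that [fine] loses nothing in [mean_sum]. *)
Definition bounded_sum h :=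
  nonneg_measurable h /\ exists B : R, forall w n, \sum_(t < n) h t w <= B.

Definition mean_sum Pr h : R := fine (sum_integral Pr h).

Lemma mean_sumE Pr h : bounded_sum h -> (mean_sum Pr h)%:E = sum_integral Pr h.
Proof.
move=> [mh [B hB]]; rewrite fineK// ge0_fin_numE ?sum_integral_ge0//.
exact: le_lt_trans (sum_integral_le Pr mh hB) (ltry _).
Qed.

Lemma mean_sum_ge0 Pr h : nonneg_measurable h -> 0 <= mean_sum Pr h.
Proof. by move=> mh; rewrite fine_ge0// sum_integral_ge0. Qed.

Lemma mean_sum_le Pr h (B : R) : nonneg_measurable h ->
  (forall w n, \sum_(t < n) h t w <= B) -> mean_sum Pr h <= B.
Proof.
move=> mh hB; have bh : bounded_sum h by split=> //; exists B.
by rewrite -lee_fin mean_sumE// sum_integral_le.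
Qed.

Lemma mean_sumD Pr h h' : bounded_sum h -> bounded_sum h' ->
  mean_sum Pr (fun t w => h t w + h' t w) = mean_sum Pr h + mean_sum Pr h'.
Proof.
move=> bh bh'; rewrite /mean_sum sum_integralD; [|exact: bh.1|exact: bh'.1].
by rewrite -!mean_sumE.
Qed.

Lemma mean_sumZ Pr h (k : R) : bounded_sum h -> 0 <= k ->
  mean_sum Pr (fun t w => k * h t w) = k * mean_sum Pr h.
Proof.
by move=> bh k0; rewrite /mean_sum sum_integralZ//; [rewrite -mean_sumE|exact: bh.1].
Qed.

Lemma bounded_sumD h h' : bounded_sum h -> bounded_sum h' ->
  bounded_sum (fun t w => h t w + h' t w).
Proof.
move=> [mh [B hB]] [mh' [B' hB']]; split.
  move=> t; have [m p] := mh t; have [m' p'] := mh' t.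
  by split=> [|w]; [exact: measurable_funD|exact: addr_ge0].
by exists (B + B') => w n; rewrite big_split lerD.
Qed.

End bounded_sums.

(** * Existence of a minimizer *)

Section risk.
Context {R : realType} {d : measure_display} {T : measurableType d}.
Context {d' : measure_display} {O : measurableType d'}.
Variable X : nat -> {mfun O >-> T}.
Local Notation process := (forall t : nat, t.-tuple T -> R).
Implicit Types (S : process) (wt : process) (Pr : probability O R).

Lemma measurable_initial t : measurable_fun setT (fun w => initial (X^~ w) t).
Proof.
apply/measurable_fun_tnthP => i.
rewrite [U in measurable_fun _ U](_ : _ = (X i : O -> T)); first exact: measurable_funP.
by apply/funext => w /=; rewrite tnth_mktuple.
Qed.

(** With [wt] the probability of a wrong decision, this is the conditional probability of stopping
    at [t] and erring. *)
Definition risk_term wt S (t : nat) (w : O) : R :=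
  mass (along S (X^~ w)) t * wt t (initial (X^~ w) t).

Definition energy_term S (t : nat) (w : O) : R := along S (X^~ w) t ^+ 2.

(** The defect in the parallelogram identity ((a+b)/2)^2 + ((a-b)/2)^2 = (a^2+b^2)/2. *)
Definition distance_term S S' (t : nat) (w : O) : R :=
  ((along S (X^~ w) t - along S' (X^~ w) t) / 2) ^+ 2.

Definition mid_process S S' : process := fun t y => (S t y + S' t y) / 2.

Definition weight wt := forall t, measurable_fun setT (wt t) /\
  forall y, 0 <= wt t y <= 1.

Lemma measurable_along S t : measurable_fun setT (S t) ->
  measurable_fun setT (fun w => along S (X^~ w) t).
Proof. by move=> mS; apply: measurableT_comp => //; exact: measurable_initial. Qed.

Section bounds.
Context (c : R) (S S' : process) (wt : process).
Hypotheses (hS : survival_process c S) (hS' : survival_process c S')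
  (hwt : weight wt).

Let mS t : measurable_fun setT (fun w => along S (X^~ w) t).
Proof. by apply: measurable_along; have [] := hS. Qed.

Lemma risk_term_le t w : 0 <= risk_term wt S t w <= mass (along S (X^~ w)) t.
Proof.
have m0 := mass_ge0 (along_itv01 hS _) (along_nonincreasing hS (X^~ w)) t.
have [_ /(_ (initial (X^~ w) t))/andP[w0 w1]] := hwt t.
by rewrite mulr_ge0//= ler_piMr.
Qed.

Lemma nonneg_measurable_risk_term : nonneg_measurable (risk_term wt S).
Proof.
move=> t; split; last by move=> w; have /andP[] := risk_term_le t w.
have [mw _] := hwt t; apply: measurable_funM; last first.
  by apply: measurableT_comp => //; exact: measurable_initial.
by case: t {mw} => [|t]; apply: measurable_funB.
Qed.

Lemma sum_risk_term_le1 w n : \sum_(t < n) risk_term wt S t w <= 1.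
Proof.
apply: (@le_trans _ _ (\sum_(t < n) mass (along S (X^~ w)) t)).
  by apply: ler_sum => t _; have /andP[] := risk_term_le t w.
case: n => [|n]; first by rewrite big_ord0.
by rewrite sum_mass; have /andP[] := along_itv01 hS (X^~ w) n; lra.
Qed.

Lemma bounded_risk_term : bounded_sum (risk_term wt S).
Proof.
by split; [exact: nonneg_measurable_risk_term|exists 1; exact: sum_risk_term_le1].
Qed.

Lemma nonneg_measurable_energy : nonneg_measurable (energy_term S).
Proof. by move=> t; split=> [|w]; [exact: measurable_funX|exact: sqr_ge0]. Qed.

(** Squaring does not increase numbers in [0,1], so the energy inherits the bound on the sums of
    [S]. *)
Lemma sum_energy_le w n : \sum_(t < n) energy_term S t w <= c.
Proof.
have [_ _ _ Sc] := hS; apply: le_trans (Sc (X^~ w) n); apply: ler_sum => t _.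
by have := along_itv01 hS (X^~ w) t; rewrite /energy_term; nra.
Qed.

Lemma bounded_energy : bounded_sum (energy_term S).
Proof.
by split; [exact: nonneg_measurable_energy|exists c; exact: sum_energy_le].
Qed.

Lemma bounded_distance : bounded_sum (distance_term S S').
Proof.
split.
  move=> t; split=> [|w]; last exact: sqr_ge0.
  apply: measurable_funX; apply: measurable_funM => //.
  by apply: measurable_funB => //; apply: measurable_along; have [] := hS'.
exists (c + c) => w n; have [_ _ _ Sc] := hS; have [_ _ _ Sc'] := hS'.
apply: le_trans (lerD (Sc (X^~ w) n) (Sc' (X^~ w) n)).
rewrite -big_split; apply: ler_sum => t _ /=; rewrite /distance_term.
have := along_itv01 hS (X^~ w) t; have := along_itv01 hS' (X^~ w) t.
set a := along S _ _; set b := along S' _ _ => /andP[b0 b1] /andP[a0 a1].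
by rewrite expr2; nra.
Qed.

End bounds.

(** [mass] is affine in the process. *)
Lemma mean_risk_mid c wt S S' Pr : weight wt ->
  survival_process c S -> survival_process c S' ->
  mean_sum Pr (risk_term wt (mid_process S S')) =
  (mean_sum Pr (risk_term wt S) + mean_sum Pr (risk_term wt S')) / 2.
Proof.
move=> hwt hS hS'; have bS := bounded_risk_term hS hwt.
have bS' := bounded_risk_term hS' hwt.
rewrite -mean_sumD// mulrC -mean_sumZ//; last exact: bounded_sumD.
congr mean_sum; apply/funext => t; apply/funext => w.
rewrite /risk_term /mass /along /mid_process; case: t => [|t]; lra.
Qed.

Lemma mean_energy_mid c S S' Pr :
  survival_process c S -> survival_process c S' ->
  mean_sum Pr (energy_term (mid_process S S')) +
    mean_sum Pr (distance_term S S') =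
  (mean_sum Pr (energy_term S) + mean_sum Pr (energy_term S')) / 2.
Proof.
move=> hS hS'; have bS := bounded_energy hS; have bS' := bounded_energy hS'.
have bM := bounded_energy (survival_process_mid hS hS').
rewrite -!mean_sumD//; last exact: bounded_distance hS hS'.
rewrite mulrC -mean_sumZ//; last exact: bounded_sumD.
congr mean_sum; apply/funext => t; apply/funext => w.
rewrite /energy_term /distance_term /along /mid_process; lra.
Qed.

End risk.

(** * Convergence of a minimizing sequence *)

Section minimal_risk.
Context {R : realType} {d : measure_display} {T : measurableType d}.
Context {d' : measure_display} {O : measurableType d'}.
Variable X : nat -> {mfun O >-> T}.
Local Notation process := (forall t : nat, t.-tuple T -> R).

(** Where survival values converge, their lower limit is the limit; the mass at [t] involves only
    the times [t - 1] and [t], hence at most two null sets. *)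
Lemma ae_cvg_mass (Pr : probability O R) (c : R) (S : nat -> process) :
  (forall k, survival_process c (S k)) ->
  (forall t, {ae Pr, forall w, cvgn (fun k => along (S k) (X^~ w) t)}) ->
  forall t, {ae Pr, forall w,
    mass (along (S k) (X^~ w)) t @[k --> \oo] -->
    mass (along (fun t y => lower_limit (fun k => S k t y)) (X^~ w)) t}.
Proof.
move=> hS cS; have lim w t : cvgn (fun k => along (S k) (X^~ w) t) ->
    along (S k) (X^~ w) t @[k --> \oo] -->
    along (fun t y => lower_limit (fun k => S k t y)) (X^~ w) t.
  move=> cw; rewrite [x in _ --> x](_ : _ = limn (fun k => along (S k) (X^~ w) t)) //.
  apply: lower_limit_cvg => // k; exact: along_itv01 (hS k) _ _.
case=> [|t].
  apply: filterS (cS 0) => w cw.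
  by apply: cvgB; [exact: cvg_cst|exact: lim].
apply: filterS2 (cS t) (cS t.+1) => w cw cw'.
by apply: cvgB; exact: lim.
Qed.

Context (Pr0 Pr1 : probability O R) (wt0 wt1 : process) (z c : R).
Hypotheses (hwt0 : weight wt0) (hwt1 : weight wt1).
Hypotheses (z0 : 0 <= z) (c0 : 0 <= c).

Definition cost (S : process) : \bar R :=
  (sum_integral Pr0 (risk_term X wt0 S)
   + z%:E * sum_integral Pr1 (risk_term X wt1 S))%E.

Definition mean_cost (S : process) : R :=
  mean_sum Pr0 (risk_term X wt0 S) + z * mean_sum Pr1 (risk_term X wt1 S).

Lemma mean_costE S : survival_process c S -> (mean_cost S)%:E = cost S.
Proof.
move=> hS; rewrite EFinD EFinM !mean_sumE//; exact: bounded_risk_term hS _.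
Qed.

Definition energy (S : process) : R :=
  mean_sum Pr0 (energy_term X S) + mean_sum Pr1 (energy_term X S).

Definition distance (S S' : process) : R :=
  mean_sum Pr0 (distance_term X S S') + mean_sum Pr1 (distance_term X S S').

(** The abstract selection with the weighted error as [J] and the energy as [N]; the tolerance is
    squared to match [ae_cvg_of_square_increments]. *)
Lemma cauchy_minimizing_processes : exists S : nat -> process,
  [/\ forall k, survival_process c (S k),
    forall k, mean_cost (S k) <=
      inf (mean_cost @` survival_process c) + geometric_rate k ^+ 2 &
    forall k, distance (S k) (S k.+1) <= 2 * geometric_rate k ^+ 2].
Proof.
(* The energy is at most [c] under each of the two hypotheses. The zero process, which stops at
   once, shows that the set is nonempty. *)
apply: (@near_minimal_midpoint_sequence _ _ _ (@mid_process R d T) _ energy _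
  (c + c)).
- exists (fun _ _ => 0); split=> //.
  + by move=> t y; rewrite lexx ler01.
  + by move=> x n; rewrite big1.
- exact: survival_process_mid.
- move=> S hS; rewrite addr_ge0// ?mulr_ge0// mean_sum_ge0//.
  + exact: nonneg_measurable_risk_term hS hwt0.
  + exact: nonneg_measurable_risk_term hS hwt1.
- move=> S S' hS hS'; rewrite /mean_cost.
  rewrite (mean_risk_mid _ _ hwt0 hS hS') (mean_risk_mid _ _ hwt1 hS hS').
  by lra.
- move=> S hS; have mS := nonneg_measurable_energy X hS.
  have bS := sum_energy_le X hS.
  by rewrite addr_ge0 ?mean_sum_ge0// lerD// mean_sum_le.
- move=> S S' hS hS'; rewrite /energy /distance.
  have := mean_energy_mid X Pr0 hS hS'; have := mean_energy_mid X Pr1 hS hS'.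
  by lra.
- by move=> k; rewrite exprn_gt0// geometric_rate_gt0.
- move=> m n mn; have : geometric_rate n <= geometric_rate m :> R by exact: nonincreasing_geometric_rate.
  have : 0 < geometric_rate n :> R by exact: geometric_rate_gt0.
  have : 0 < geometric_rate m :> R by exact: geometric_rate_gt0.
  by nra.
Qed.

(** A single time contributes at most the whole distance, so the increments at each fixed time meet
    the bound required for almost sure convergence. *)
Lemma ae_cvg_along (Pr : probability O R) (S : nat -> process) :
  (forall k, survival_process c (S k)) ->
  (forall k, mean_sum Pr (distance_term X (S k) (S k.+1)) <=
    2 * geometric_rate k ^+ 2) ->
  forall t, {ae Pr, forall w, cvgn (fun k => along (S k) (X^~ w) t)}.
Proof.
move=> hS dS t.
apply: (ae_cvg_of_square_increments (f := fun k w => along (S k) (X^~ w) t)) => k.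
  by apply: measurable_along; have [mS _ _ _] := hS k; exact: mS.
have bd := bounded_distance X (hS k) (hS k.+1).
apply: (@le_trans _ _ (mean_sum Pr (distance_term X (S k) (S k.+1)))%:E).
  rewrite mean_sumE//.
  apply: le_trans (partial_sum_integral_le Pr t.+1 bd.1).
  rewrite big_nat_recr//= leeDr// sume_ge0// => n _.
  by apply: integral_ge0 => w _; rewrite lee_fin sqr_ge0.
by rewrite lee_fin.
Qed.

(** The lower limit [L] of the minimizing sequence is optimal. Limits are taken in turn: in [k] for
    partial sums up to a fixed [n], then in [n]. *)
Lemma exists_minimal_survival_process : exists2 S, survival_process c S &
  forall S', survival_process c S' -> (cost S <= cost S')%E.
Proof.
have [S [hS minS dS]] := cauchy_minimizing_processes.
pose L : process := fun t y => lower_limit (fun k => S k t y).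
have hL : survival_process c L by exact: survival_process_lower_limit.
have d0 Pr k : 0 <= mean_sum Pr (distance_term X (S k) (S k.+1)).
  by apply: mean_sum_ge0; exact: (bounded_distance X (hS k) (hS k.+1)).1.
set A := inf _ in minS.
have lim Pr wt n : weight wt ->
    (forall k, mean_sum Pr (distance_term X (S k) (S k.+1)) <=
      2 * geometric_rate k ^+ 2) ->
    (\sum_(0 <= t < n) \int[Pr]_w (risk_term X wt (S k) t w)%:E)%E
      @[k --> \oo] -->
    (\sum_(0 <= t < n) \int[Pr]_w (risk_term X wt L t w)%:E)%E.
  move=> hwt dPr; apply: cvg_partial_sum_integral => [k||k t w|t].
  - exact: nonneg_measurable_risk_term (hS k) hwt.
  - exact: nonneg_measurable_risk_term hL hwt.
  - have /andP[_ le] := risk_term_le X (hS k) hwt t w.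
    by rewrite (le_trans le)// mass_le1//; exact: along_itv01 (hS k) _.
  - apply: filterS (ae_cvg_mass hS (ae_cvg_along hS dPr) t) => w h.
    by apply: cvgM => //; exact: cvg_cst.
have dS0 k : mean_sum Pr0 (distance_term X (S k) (S k.+1)) <=
    2 * geometric_rate k ^+ 2.
  by apply: le_trans (dS k); rewrite lerDl.
have dS1 k : mean_sum Pr1 (distance_term X (S k) (S k.+1)) <=
    2 * geometric_rate k ^+ 2.
  by apply: le_trans (dS k); rewrite lerDr.
have nm0 P := nonneg_measurable_risk_term X P hwt0.
have nm1 P := nonneg_measurable_risk_term X P hwt1.
have partial_ge0 (Pr : probability O R) wt P n : weight wt -> survival_process c P ->
    (0 <= \sum_(0 <= t < n) \int[Pr]_w (risk_term X wt P t w)%:E)%E.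
  move=> hwt hP; apply: sume_ge0 => t _; apply: integral_ge0 => w _.
  by rewrite lee_fin; have /andP[] := risk_term_le X hP hwt t w.
have def (a b : \bar R) : (0 <= a)%E -> (0 <= b)%E -> (a +? z%:E * b)%E.
  by move=> a0 b0; rewrite ge0_adde_def// inE// mule_ge0// lee_fin.
have costL : (cost L <= A%:E)%E.
  have cvgL := cvgeD (def _ _ (sum_integral_ge0 Pr0 (nm0 _ _ hL))
      (sum_integral_ge0 Pr1 (nm1 _ _ hL)))
    (cvg_sum_integral (Pr := Pr0) (nm0 _ _ hL))
    (cvgeZl (isT : z%:E \is a fin_num) (cvg_sum_integral (Pr := Pr1) (nm1 _ _ hL))).
  apply: (cvge_le _ (cvgL _)); apply: nearW => n.
  have cvgS := cvgeD (def _ _ (partial_ge0 Pr0 _ _ n hwt0 hL)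
      (partial_ge0 Pr1 _ _ n hwt1 hL))
    (lim Pr0 _ n hwt0 dS0)
    (cvgeZl (isT : z%:E \is a fin_num) (lim Pr1 _ n hwt1 dS1)).
  apply/lee_addgt0Pr => e e0; apply: (cvge_le _ (cvgS _)).
  have q0 : geometric_rate k ^+ 2 @[k --> \oo] --> (0 : R).
    apply: (@squeeze_cvgr _ _ _ _ (cst 0) harmonic).
    - apply: nearW => k; rewrite sqr_ge0/=.
      have q1 : (geometric_rate k : R) <= 1 / k.+1%:R.
        by rewrite ler_pM2l// lef_pV2 ?posrE ?ltr0n ?expn_gt0// ler_nat ltnW// ltn_expl.
      rewrite /= -div1r (le_trans _ q1)// expr2 ler_piMl//.
        exact/ltW/geometric_rate_gt0.
      by rewrite (le_trans q1)// ler_pdivrMr// mul1r ler1n.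
    - exact: cvg_cst.
    - exact: cvg_harmonic.
  have : \forall k \near \oo, (geometric_rate k ^+ 2 : R) < e.
    by apply: (cvgr_lt _ q0).
  apply: filterS => k qe.
  (* Partial sums of nonnegative terms are at most the full cost, which is within
     [geometric_rate k ^+ 2] of the infimum. *)
  apply: (@le_trans _ _ (cost (S k))).
    apply: leeD; first exact: partial_sum_integral_le (nm0 _ _ (hS k)).
    by rewrite lee_wpmul2l ?lee_fin//; exact: partial_sum_integral_le (nm1 _ _ (hS k)).
  rewrite -mean_costE// -EFinD lee_fin (le_trans (minS k))// lerD2l.
  exact: ltW.
exists L => // S' hS'; apply: (le_trans costL).
rewrite -mean_costE// lee_fin; apply: ge_inf; last by exists S'.
exists 0 => _ [P hP <-]; rewrite addr_ge0// ?mulr_ge0// mean_sum_ge0//.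
- exact: (nm0 _ _ hP).
- exact: (nm1 _ _ hP).
Qed.

End minimal_risk.

(** * Truncation and the limit of rho_k *)

Section errors.
Context {R : realType} {d : measure_display} {T : measurableType d}.
Context {d' : measure_display} {O : measurableType d'}.
Context (p0 p1 : T -> R) (tie : randomized_rule R T) (z : R).
Context (Pr0 Pr1 : probability O R) (X : nat -> {mfun O >-> T}).
Hypotheses (mp0 : measurable_fun setT p0) (mp1 : measurable_fun setT p1).
Hypothesis z0 : 0 <= z.

Let accept1 (t : nat) (y : t.-tuple T) : R := decide1 p0 p1 tie z y.
Let accept0 (t : nat) (y : t.-tuple T) : R := 1 - decide1 p0 p1 tie z y.

Lemma measurable_likelihood_ratio t :
  measurable_fun setT (fun y : t.-tuple T => likelihood_ratio p0 p1 y).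
Proof.
apply: measurable_prod => i _; have mi := @measurable_tnth _ T t i.
by apply: measurable_fun_div; apply: measurableT_comp mi.
Qed.

Lemma weight_decide1 : weight accept1.
Proof.
move=> t; split.
  have ml : measurable_fun setT
      (fun y : t.-tuple T => z * likelihood_ratio p0 p1 y).
    by apply: measurable_funM => //; exact: measurable_likelihood_ratio.
  apply: measurable_fun_ifT => //; first exact: measurable_fun_ltr.
  apply: measurable_fun_ifT => //; first exact: measurable_fun_ltr.
  exact: rule_measurable.
move=> y; rewrite /accept1 /decide1; case: ifP => _; first by rewrite ler01 lexx.
case: ifP => _; first by rewrite lexx ler01.
exact: rule_itv01.
Qed.

Lemma weight_decide0 : weight accept0.
Proof.
move=> t; have [m b] := weight_decide1 t; split; first exact: measurable_funB.
by move=> y; have := b y; rewrite /accept0 /accept1; lra.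
Qed.

Local Notation error := (weighted_error p0 p1 tie z Pr0 Pr1 X).

Lemma weighted_errorE psi :
  error psi = cost X Pr0 Pr1 accept1 accept0 z (@survival _ _ _ psi).
Proof.
rewrite /weighted_error /cost /type1_error /type2_error /sum_integral.
by congr (_ + _ * _)%E; apply: eq_eseriesr => t _; apply: eq_integral => w _;
  rewrite /risk_term stop_probE.
Qed.

Lemma weighted_error_has_minimum (c : R) : 0 <= c ->
  exists2 psi, constrained_policies c psi &
    forall psi', constrained_policies c psi' -> (error psi <= error psi')%E.
Proof.
move=> c0; have [S hS minS] := exists_minimal_survival_process X Pr0 Pr1
  weight_decide1 weight_decide0 z0 c0.
have [psi psiE] := survival_process_policy hS.
exists psi; first by apply/constrained_policiesP => //; rewrite psiE.
move=> psi' /(constrained_policiesP _ c0) h.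
by rewrite !weighted_errorE psiE; exact: minS.
Qed.

(** The policies agree before time [k.+1]; the mass surviving past time [k], now all placed at
    [k.+1], is at most [c / k.+1], and weights are at most 1. *)
Lemma truncated_risk_le (Pr : probability O R) (c : R) wt psi psi' (k : nat) :
  weight wt -> survival_process c (@survival _ _ _ psi) ->
  survival_process c (@survival _ _ _ psi') ->
  (forall t (y : t.-tuple T), psi' t y = truncated_prob psi k.+1 y) ->
  mean_sum Pr (risk_term X wt (@survival _ _ _ psi')) <=
  mean_sum Pr (risk_term X wt (@survival _ _ _ psi)) + c / k.+1%:R.
Proof.
move=> hwt hS hS' psi'E; have bS := bounded_risk_term X hS hwt.
have bS' := bounded_risk_term X hS' hwt.
(* The risk of the mass placed at [k.+1], an upper bound for the excess over [psi]. *)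
pose tail (t : nat) (w : O) : R := if t == k.+1
  then along (@survival _ _ _ psi) (X^~ w) k * wt t (initial (X^~ w) t) else 0.
have tail_le t w : 0 <= tail t w <= if t == k.+1 then c / k.+1%:R else 0.
  rewrite /tail; case: ifP => _; last by rewrite lexx.
  have [_ /(_ (initial (X^~ w) t))/andP[w0 w1]] := hwt t.
  have /andP[s0 _] := along_itv01 hS (X^~ w) k.
  rewrite mulr_ge0//= (le_trans (ler_piMr _ w1))// ler_pdivlMr// mulrC.
  apply: time_survival_le; first exact: along_nonincreasing hS _.
  by have [_ _ _ ?] := hS.
have sum_tail w n : \sum_(t < n) tail t w <= c / k.+1%:R.
  have c0 : 0 <= c by have [_ _ _ /(_ (X^~ w) 0)] := hS; rewrite big_ord0.
  have e0 : 0 <= c / k.+1%:R by rewrite divr_ge0.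
  apply: (@le_trans _ _ (\sum_(t < n) if t == k.+1 :> nat then c / k.+1%:R else 0)).
    by apply: ler_sum => t _; have /andP[] := tail_le t w.
  rewrite -(big_mkord predT (fun t => if t == k.+1 then c / k.+1%:R else 0)).
  rewrite -big_mkcond big_nat1_eq; by case: ifP.
have mtail : nonneg_measurable tail.
  move=> t; split; last by move=> w; have /andP[] := tail_le t w.
  rewrite /tail; case: (t == k.+1) => //; apply: measurable_funM.
    by apply: measurable_along; have [mS _ _ _] := hS; exact: mS.
  by apply: measurableT_comp; [have [] := hwt t|exact: measurable_initial].
have btail : bounded_sum tail by split=> //; exists (c / k.+1%:R).
apply: (@le_trans _ _ (mean_sum Pr (risk_term X wt (@survival _ _ _ psi)) +
    mean_sum Pr tail)); last by rewrite lerD2l mean_sum_le.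
rewrite -mean_sumD// -lee_fin !mean_sumE//; last exact: bounded_sumD.
apply: lee_nneseries => t _.
  by move=> _; apply: integral_ge0 => w _; rewrite lee_fin; have [_ ->] := bS'.1 t.
have [m p] := (bounded_sumD bS btail).1 t; have [m' p'] := bS'.1 t.
apply: ge0_le_integral => //.
- by move=> w _; rewrite lee_fin.
- exact/measurable_EFinP.
- exact/measurable_EFinP.
move=> w _; rewrite lee_fin /risk_term (mass_truncated psi'E) /tail.
have [_ /(_ (initial (X^~ w) t))/andP[w0 w1]] := hwt t.
have m0 := mass_ge0 (along_itv01 hS _) (along_nonincreasing hS (X^~ w)) t.
case: ltnP => [tk|_]; first by rewrite ltn_eqF// addr0.
by case: eqP => _; rewrite ?mul0r ?addr0 ?lerDr mulr_ge0.
Qed.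

Local Notation rho c k := (rho_ p0 p1 tie z Pr0 Pr1 X k c).

Lemma rho_ge (c : R) (v : \bar R) k :
  (forall psi, constrained_policies c psi -> (v <= error psi)%E) ->
  (v <= rho c k)%E.
Proof. by move=> vmin; apply: le_ereal_inf_tmp => _ [psi [h _] <-]; exact: vmin. Qed.

(** Truncating [psi] at [k.+1] costs at most [c / k.+1] in each error probability, the second being
    weighted by [z]. *)
Lemma rho_succ_le (c : R) psi k : 0 <= c -> constrained_policies c psi ->
  (rho c k.+1 <= error psi + ((1 + z) * (c / k.+1%:R))%:E)%E.
Proof.
move=> c0 hpsi; have [psi' psi'E] := truncated_policy psi k.+1.
have hpsi' := truncated_constrained psi'E c0 hpsi.
have hS := (constrained_policiesP psi c0).1 hpsi.
have hS' := (constrained_policiesP psi' c0).1 hpsi'.1.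
apply: (@le_trans _ _ (error psi')); first by apply: ereal_inf_lbound; exists psi'.
rewrite !weighted_errorE.
rewrite -(mean_costE X Pr0 Pr1 z weight_decide1 weight_decide0 hS).
rewrite -(mean_costE X Pr0 Pr1 z weight_decide1 weight_decide0 hS').
rewrite -EFinD lee_fin /mean_cost.
have := truncated_risk_le Pr0 weight_decide1 hS hS' psi'E.
have := ler_wpM2l z0 (truncated_risk_le Pr1 weight_decide0 hS hS' psi'E).
by move: (c / _) => e; rewrite mulrDr mulrDl mul1r; lra.
Qed.

Lemma rho_cvg (c : R) psi : 0 <= c -> constrained_policies c psi ->
  (forall psi', constrained_policies c psi' -> (error psi <= error psi')%E) ->
  rho c k @[k --> \oo] --> error psi.
Proof.
(* The upper bound concerns [k.+1] randomized decisions, so the squeeze is applied to the shifted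
   sequence. *)
move=> c0 hpsi minpsi; rewrite -(cvg_shiftS (fun k => rho c k)).
have hS := (constrained_policiesP psi c0).1 hpsi.
(* Finiteness ensures that the sum of the limits is well defined in the extended reals. *)
have fin : error psi \is a fin_num.
  rewrite weighted_errorE.
  by rewrite -(mean_costE X Pr0 Pr1 z weight_decide1 weight_decide0 hS).
apply: (@squeeze_cvge _ _ _ _ (cst (error psi)) _
  (fun k => error psi + ((1 + z) * (c / k.+1%:R))%:E)%E).
- by apply: nearW => k; rewrite rho_ge//= rho_succ_le.
- exact: cvg_cst.
- rewrite -[X in _ --> X]adde0; apply: cvgeD; first by rewrite fin_num_adde_defr.
    exact: cvg_cst.
  apply: cvg_EFin; first exact: nearW.
  suff : (1 + z) * (c * harmonic k) @[k --> \oo] --> (1 + z) * (c * 0).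
    by rewrite !mulr0.
  by do 2 apply: cvgMl_tmp; exact: cvg_harmonic.
Qed.

End errors.

Unset Implicit Arguments.

Theorem lemma4p5 (R : realType)
    (d : measure_display) (T : measurableType d)
    (P0 P1 : probability T R)
    (mu : {sigma_finite_measure set T -> \bar R}) (p0 p1 : T -> R)
    (hp0 : is_density mu P0 p0) (hp1 : is_density mu P1 p1)
    (P1_ac_P0 : P1 `<< P0)
    (kl_neq0 : kl_divergence mu p0 p1 <> 0%E)
    (kl_finite : kl_divergence mu p0 p1 \is a fin_num)
    (d' : measure_display) (O : measurableType d') (Pr0 Pr1 : probability O R)
    (X : nat -> {mfun O >-> T})
    (X_iid0 : iid_according_to Pr0 X P0) (X_iid1 : iid_according_to Pr1 X P1)
    (tie : randomized_rule R T) (z c : R) (z_ge0 : 0 <= z) (c_ge0 : 0 <= c) :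
  let rho_k := fun k : nat => rho_ p0 p1 tie z Pr0 Pr1 X k c in
  let rho := limn rho_k in
  rho_k k @[k --> \oo] --> rho /\
  is_minimum (constrained_policies c)
    (weighted_error p0 p1 tie z Pr0 Pr1 X) rho.
Proof.
have [mp0 _ _] := hp0; have [mp1 _ _] := hp1.
have [psi hpsi min_psi] :=
  weighted_error_has_minimum tie Pr0 Pr1 X mp0 mp1 z_ge0 c_ge0.
have cvg_rho := rho_cvg mp0 mp1 z_ge0 c_ge0 hpsi min_psi.
(* Uniqueness of limits identifies [rho] with the error of the minimizer, giving convergence and
   attainment together. *)
move=> rho_k rho; have -> : rho = weighted_error p0 p1 tie z Pr0 Pr1 X psi.
  exact: cvg_lim.
by split=> //; split=> //; exists psi.
Qed.
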